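(* Let $G=(V,E)$ be a finite connected planar graph with coupling constants $J:E\to(0,\infty)$, let $W$ be the set of vertices on its outer face, let $A,B\subset W$ (possibly intersecting) be such that $|A|=|B|$, and let $\vec G$ be one of the directed modifications of $G$ described in the context. Let $\omega=(\omega_1,\omega_2)\in\Gamma_{A,B}$, and let $k'(\omega)$ be the number of connected components of $\omega$ that contain a vertex in $A\cup B$. Then the probability of $\omega$ induced from the random alternating flow measure is given by $$\overline{\mathbf P}^{A,B}_{\mathrm{a\text{-}flow}}(\omega)=\frac1{\bar Z^{A,B}_{\mathrm{a\text{-}flow}}}\,2^{|A|-k'(\omega)}\,|\mathcal E_\emptyset(\omega)|\prod_{e\in\omega_1}x_e\prod_{e\in\omega_2}x_e^2\prod_{e\in E\setminus\omega}(1-x_e^2),$$ where $\bar Z^{A,B}_{\mathrm{a\text{-}flow}}=Z^{A,B}_{\mathrm{a\text{-}flow}}\prod_{e\in E}(1-x_e^2)$. In particular, $\overline{\mathbf P}^{A,B}_{\mathrm{a\text{-}flow}}=\overline{\mathbf P}^{B,A}_{\mathrm{a\text{-}flow}}$.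
   Context: Setup: $W=W_\circ\cup W_\bullet$ is a partition of $W$ into two sets (one possibly empty); $x_e=\tanh J_e$. Directed modification $\vec G=(V\cup W^+\cup W^-,\vec E)$: each edge $e\in E$ is replaced by three directed edges, a middle edge $\vec e_m$ and two side edges $\vec e_{s1},\vec e_{s2}$ lying on opposite sides of $\vec e_m$ and having the opposite orientation to $\vec e_m$; the orientation of each middle edge is chosen arbitrarily. The weights are $x_{\vec e_m}=\frac{\sinh 2J_e}2=\frac{x_e}{1-x_e^2}$ and $x_{\vec e_{s1}}=x_{\vec e_{s2}}=\frac{\tanh J_e}2=\frac{x_e}2$. For each $w\in W$, a source vertex $w^+\in W^+$ and a sink vertex $w^-\in W^-$ with directed edges $(w^+,w)$ and $(w,w^-)$ of weight $1$ are placed in the outer face of $G$, so that in the counterclockwise order around the outer face $w^-$ comes immediately before (resp. after) $w^+$ if $w\in W_\circ$ (resp. $w\in W_\bullet$). Alternating flows: a flow on $\vec G$ is a set $F\subseteq\vec E$ such that each vertex of $V$ has the same number of ingoing and outgoing edges in $F$. It is alternating if for each $v\in V$ the edges of $F$ alternate in orientation (towards or away from $v$) around $v$. $V(F)$ is the set of vertices incident on at least one edge of $F$. For $U\subseteq W$, $U^+\subseteq W^+$ and $U^-\subseteq W^-$ are the corresponding sets of sources and sinks. $\mathcal F_{A,B}$ is the set of alternating flows $F$ on $\vec G$ with $V(F)\cap W^+=A^+$ and $V(F)\cap W^-=B^-$. The weight of $F\in\mathcal F_{A,B}$ is $\mathrm w(F)=2^{|A|+|F|-|V(F)|}\prod_{\vec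 e\in F}x_{\vec e}$. The random alternating flow measure is $\mathbf P^{A,B}_{\mathrm{a\text{-}flow}}(F)=\mathrm w(F)/Z^{A,B}_{\mathrm{a\text{-}flow}}$, with $Z^{A,B}_{\mathrm{a\text{-}flow}}=\sum_{F\in\mathcal F_{A,B}}\mathrm w(F)$. Induced configurations: to $F\in\mathcal F_{A,B}$ associate $\omega(F)=(\omega_1(F),\omega_2(F))$, where $\omega_1(F)$ is the set of $e\in E$ such that $F$ contains an odd number of the edges $\vec e_m,\vec e_{s1},\vec e_{s2}$ (i.e. $F$ restricted to these is $\{\vec e_m\}$, $\{\vec e_{s1}\}$, $\{\vec e_{s2}\}$ or all three), and $\omega_2(F)$ is the set of $e\in E$ such that $F$ contains exactly two of them (necessarily $\vec e_m$ and one side edge, by the alternating condition). $\Gamma_{A,B}$ is the image of $\mathcal F_{A,B}$ under $F\mapsto\omega(F)$. Let $\mathcal E_S$ be the collection of sets of edges of $G$ for which $S$ is the set of vertices of odd degree in the induced subgraph, and $\Gamma_S=\{(\omega_1,\omega_2):\omega_1\in\mathcal E_S,\ \omega_2\subseteq E\setminus\omega_1\}$; then $\Gamma_{A,B}\subseteq\Gamma_{A\triangle B}$. $\overline{\mathbf P}^{A,B}_{\mathrm{a\text{-}flow}}$ is the probability measure on $\Gamma_{A\triangle B}$, supported on $\Gamma_{A,B}$, that is the push-forward of $\mathbf P^{A,B}_{\mathrm{a\text{-}flow}}$ under $F\mapsto\omega(F)$. A pair $\omega$ is often identified with $\omega_1\cup\omega_2\subseteq E$, and $\mathcal E_\emptyset(\omega)=\{\omega'\in\mathcal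 E_\emptyset:\omega'\subseteq\omega\}$. In counting $k'(\omega)$, a vertex of $A\cup B$ not incident to any edge of $\omega$ counts as a connected component of its own.
   Formalization: The final symmetry claim fails on one fixed directed modification when A and B intersect; it is proved there for disjoint A, B, and for all A, B with W_∘ and W_• exchanged in the modification used for the measure with A and B swapped. *)

(* Defs.v *)
From HB Require Import structures.
From mathcomp Require Import all_boot all_order all_algebra.
From mathcomp Require Import fingroup perm.
From mathcomp Require Import reals sequences exp.

Set Implicit Arguments.
Unset Strict Implicit.
Unset Printing Implicit Defensive.

Import Order.TTheory GRing.Theory Num.Theory.
Local Open Scope ring_scope.

(** * Plane graphs as rotation systems

A dart is an edge together with one of its two directions.  A plane graph is
given by the counterclockwise cyclic order [rot] of the darts leaving each
vertex, subject to Euler's formula.  Multiple edges and loops are allowed. *)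

Definition opp_dart (E : Type) (d : E * bool) : E * bool := (d.1, ~~ d.2).

(* The dart following [d] along the boundary of the face on the left of [d]. *)
Definition face_next (E : finType) (rot : {perm E * bool}) (d : E * bool)
    : E * bool :=
  (rot^-1)%g (opp_dart d).

(* A face is identified with the set of darts having it on their left. *)
Definition faces (E : finType) (rot : {perm E * bool}) : {set {set E * bool}} :=
  [set [set d' | fconnect (face_next rot) d d'] | d : E * bool].

Record plane_graph := PlaneGraph {
  vertex : finType;
  edge : finType;
  org : edge * bool -> vertex;
  rot : {perm edge * bool};
  outer_face : {set edge * bool};
  rotP : forall d d', (org d == org d') = fconnect rot d d';
  connectedP : forall u v : vertex,
    connect [rel a b | [exists d, (org d == a) && (org (opp_dart d) == b)]] u v;
  (* Without edges the plane still has one face, which contains no dart; hence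
     the [maxn 1]. *)
  eulerP : (#|vertex| + maxn 1 #|faces rot| = #|edge| + 2)%N;
  outer_faceP : (0 < #|edge|)%N -> outer_face \in faces rot
}.

Notation dart G := (edge G * bool)%type.

(* The set W.  If there are no edges, the only vertex lies on the outer face. *)
Definition outer_vertices (G : plane_graph) : {set vertex G} :=
  [set v | [exists d in outer_face G, org d == v] || (#|edge G| == 0)%N].

Definition outer_vertex (G : plane_graph) :=
  {v : vertex G | v \in outer_vertices G}.

(** * The directed modification *)

(* [mid_dir e] selects the dart of [e] giving the orientation of its middle
   edge.  The corner between [d] and [rot d] at [org d] lies on the left of [d].
   [corner] designates a corner at every vertex of positive degree; for a vertex
   of W it is a corner of the outer face, the one where the source and sink are
   attached (there can be several such corners at a cut vertex), and for the
   other vertices it merely provides a starting point for listing the darts. *)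
Record directed_modification (G : plane_graph) := DirectedModification {
  W_circ : {set outer_vertex G};
  mid_dir : edge G -> bool;
  corner : vertex G -> option (dart G);
  cornerP : forall v d, corner v = Some d ->
    org d = v /\ (v \in outer_vertices G -> d \in outer_face G);
  corner_NoneP : forall v, corner v = None -> forall d, org d != v
}.

Definition W_bullet (G : plane_graph) (N : directed_modification G)
  : {set outer_vertex G} := ~: W_circ N.

(* The directed modification with the roles of W_circ and W_bullet exchanged.
   Reversing all edges of an alternating flow exchanges A and B, but at a vertex
   of A :&: B, where the source and the sink are both used, alternation then
   requires them to be placed in the opposite order. *)
Definition swap_circ_bullet (G : plane_graph) (N : directed_modification G)
    : directed_modification G :=
  DirectedModification (W_bullet N) (mid_dir N) (@cornerP G N)
    (@corner_NoneP G N).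

(* [side d], for a dart [d] of [e], is the side edge of [e] lying on the left of
   [d], so the two side edges of [e] are [side (e, true)] and [side (e, false)]. *)
Definition directed_edge (G : plane_graph) :=
  (edge G + dart G + outer_vertex G + outer_vertex G)%type.

Definition mid (G : plane_graph) (e : edge G) : directed_edge G := inl (inl (inl e)).
Definition side (G : plane_graph) (d : dart G) : directed_edge G := inl (inl (inr d)).
Definition source_arc (G : plane_graph) (w : outer_vertex G)
    : directed_edge G :=
  inl (inr w).
Definition sink_arc (G : plane_graph) (w : outer_vertex G)
    : directed_edge G := inr w.

Definition dvertex (G : plane_graph) :=
  (vertex G + outer_vertex G + outer_vertex G)%type.

Definition inner (G : plane_graph) (v : vertex G) : dvertex G := inl (inl v).
Definition source (G : plane_graph) (w : outer_vertex G) : dvertex G :=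
  inl (inr w).
Definition sink (G : plane_graph) (w : outer_vertex G) : dvertex G := inr w.

Section DirectedModificationTheory.
Variables (G : plane_graph) (N : directed_modification G).

Definition arc_tail (a : directed_edge G) : dvertex G :=
  match a with
  | inl (inl (inl e)) => inner (org (e, mid_dir N e))
  | inl (inl (inr (e, _))) => inner (org (e, ~~ mid_dir N e))
  | inl (inr w) => source w
  | inr w => inner (val w)
  end.

Definition arc_head (a : directed_edge G) : dvertex G :=
  match a with
  | inl (inl (inl e)) => inner (org (e, ~~ mid_dir N e))
  | inl (inl (inr (e, _))) => inner (org (e, mid_dir N e))
  | inl (inr w) => inner (val w)
  | inr w => sink w
  end.

(* Half-arcs are listed counterclockwise around a vertex; the boolean is [true]
   when the half-arc points away from the vertex.  A directed loop contributes
   two half-arcs. *)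

(* The half-arcs replacing the dart [d]: counterclockwise around [org d], one
   meets the right-hand side of [d] first. *)
Definition dart_half_arcs (d : dart G) : seq (directed_edge G * bool) :=
  let out := d.2 == mid_dir N d.1 in
  [:: (side (opp_dart d), ~~ out); (mid d.1, out); (side d, ~~ out)].

(* At a vertex of W, counterclockwise around that vertex within a corner of the
   outer face agrees with counterclockwise around the outer boundary of G. *)
Definition outer_half_arcs (v : vertex G) : seq (directed_edge G * bool) :=
  if insub v is Some w then
    if w \in W_circ N then [:: (sink_arc w, true); (source_arc w, false)]
    else [:: (source_arc w, false); (sink_arc w, true)]
  else [::].

Definition half_arcs (v : vertex G) : seq (directed_edge G * bool) :=
  (if corner N v is Some d
   then flatten [seq dart_half_arcs d' | d' <- fingraph.orbit (rot G) (rot G d)]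
   else [::]) ++ outer_half_arcs v.

(** * Alternating flows *)

Definition is_flow (F : {set directed_edge G}) : bool :=
  [forall v : vertex G,
    #|[set a in F | arc_head a == inner v]| == #|[set a in F | arc_tail a == inner v]|].

Definition alternating (F : {set directed_edge G}) : bool :=
  [forall v : vertex G,
    path.cycle (fun b b' : bool => b != b')
      [seq h.2 | h <- half_arcs v & h.1 \in F]].

Definition flow_vertices (F : {set directed_edge G}) : {set dvertex G} :=
  [set u | [exists a in F, (arc_tail a == u) || (arc_head a == u)]].

Definition alt_flows (A B : {set vertex G}) : {set {set directed_edge G}} :=
  [set F | [&& is_flow F, alternating F,
    [forall w : outer_vertex G,
      (source w \in flow_vertices F) == (val w \in A)] &
    [forall w : outer_vertex G,
      (sink w \in flow_vertices F) == (val w \in B)]]].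

End DirectedModificationTheory.

(** * Configurations induced on the edges of G *)

Section Configurations.
Variable G : plane_graph.
Implicit Types (F : {set directed_edge G}) (om : {set edge G} * {set edge G}).

Definition arc_count F (e : edge G) : nat :=
  ((mid e \in F) + (side (e, true) \in F) + (side (e, false) \in F))%N.

Definition omega F : {set edge G} * {set edge G} :=
  ([set e | odd (arc_count F e)], [set e | arc_count F e == 2]).

Definition Gamma (N : directed_modification G) (A B : {set vertex G})
  : {set {set edge G} * {set edge G}} := [set omega F | F in alt_flows N A B].

(* Loops count twice. *)
Definition degree (S : {set edge G}) (v : vertex G) : nat :=
  #|[set d : dart G | (d.1 \in S) && (org d == v)]|.

Definition odd_vertices (S : {set edge G}) : {set vertex G} :=
  [set v | odd (degree S v)].

Definition E_ (U : {set vertex G}) : {set {set edge G}} :=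
  [set S | odd_vertices S == U].

Definition edges_of om : {set edge G} := om.1 :|: om.2.

Definition E_empty_in om : {set {set edge G}} :=
  [set S in E_ set0 | S \subset edges_of om].

(* The vertex set of the connected component of [v] in (V, omega). *)
Definition component om (v : vertex G) : {set vertex G} :=
  [set u | connect
    [rel a b | [exists d : dart G,
      [&& d.1 \in edges_of om, org d == a & org (opp_dart d) == b]]] v u].

Definition kprime (A B : {set vertex G}) om : nat :=
  #|[set component om v | v in A :|: B]|.

End Configurations.

(** * Weights and measures *)

Definition sinh (R : realType) (t : R) : R := (expR t - expR (- t)) / 2.
Definition cosh (R : realType) (t : R) : R := (expR t + expR (- t)) / 2.
Definition tanh (R : realType) (t : R) : R := sinh t / cosh t.

Section Measures.
Variables (R : realType) (G : plane_graph) (J : edge G -> R).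
Variable N : directed_modification G.

Definition x_ (e : edge G) : R := tanh (J e).

Definition arc_weight (a : directed_edge G) : R :=
  match a with
  | inl (inl (inl e)) => sinh (2 * J e) / 2
  | inl (inl (inr (e, _))) => tanh (J e) / 2
  | inl (inr _) | inr _ => 1
  end.

(* The exponent is an integer, possibly negative. *)
Definition flow_weight (A : {set vertex G}) (F : {set directed_edge G}) : R :=
  (2 : R) ^ (#|A|%:Z + #|F|%:Z - #|flow_vertices N F|%:Z)
  * \prod_(a in F) arc_weight a.

Definition Z_aflow (A B : {set vertex G}) : R :=
  \sum_(F in alt_flows N A B) flow_weight A F.

Definition P_aflow (A B : {set vertex G}) (F : {set directed_edge G}) : R :=
  if F \in alt_flows N A B then flow_weight A F / Z_aflow A B else 0.

(* Probability mass function of the push-forward of [P_aflow] under [omega]. *)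
Definition Pbar_aflow (A B : {set vertex G})
    (om : {set edge G} * {set edge G}) : R :=
  \sum_(F : {set directed_edge G} | omega F == om) P_aflow A B F.

Definition Zbar_aflow (A B : {set vertex G}) : R :=
  Z_aflow A B * \prod_(e : edge G) (1 - x_ e ^+ 2).

End Measures.

(* Main.v *)
Require Import Defs.
From HB Require Import structures.
From mathcomp Require Import all_boot all_order all_algebra.
From mathcomp Require Import fingroup perm.
From mathcomp Require Import reals sequences exp.
From mathcomp Require Import zify ring.

Set Implicit Arguments.
Unset Strict Implicit.
Unset Printing Implicit Defensive.

Import Order.TTheory GRing.Theory Num.Theory.
Local Open Scope ring_scope.

(** Fix [om].  Sweeping counterclockwise around a vertex, the up to three
arcs of a flow inside one edge can be merged into a single slot.  If the edge
lies in [om.1], the slot contains an odd number of arcs, so in an alternating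
sweep it acts as one arc; if it lies in [om.2], it contains the middle arc and
one side arc, so it leaves the expected direction of the next arc unchanged.
In both cases the slot is determined, as far as alternation is concerned, by the
direction of its last arc, and the slots at the two ends of an edge determine
each other.  A flow inducing [om] thus has a [sense], one bit per edge of [om],
and it alternates if and only if these bits satisfy a condition at every vertex
([alternating_orientation]).

For a prescribed bit the local weights of the arc sets realizing it add up to
[2 x / (1 - x^2)] on [om.1] and to [2 x^2 / (1 - x^2)] on [om.2], whatever the
bit is ([sum_admissible]): this is what the choice of weights achieves.  Hence
the mass of [om] is a product over edges times the number of admissible choices
of bits ([massE]).

The condition at a vertex propagates from one slot to the next, so two
solutions either agree or are opposite all around a vertex, hence throughout a
component of [om].  If a source or sink is attached to the component, its
direction is imposed and the two solutions agree there.  As [om] is in the image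
of the flows, a solution exists, and the number of solutions is two to the
number of nontrivial components avoiding A and B ([card_orientations]).  The
number of even subgraphs is [2 ^ (edges - vertices + components)]
([card_cycles]), and comparing the two powers of two yields the formula
([orientations_cycles]).

Exchanging A and B amounts to reversing all arcs, that is, to flipping all bits.
This preserves the conditions as soon as the order of the source and the sink is
reversed at the vertices where both are used ([reversed_card_orientations]). *)

(** * Alternation around a vertex *)

Definition differ (b c : bool) : bool := b != c.

(** Consecutive letters cancel in pairs; [c] stands for the letter preceding the
word. *)
Lemma path_differ_count c s : path differ c s ->
  (count id s + c = count negb s + last c s)%N.
Proof.
elim: s c => [|b s IH] c //=; case/andP=> cb /IH.
by move: cb; case: b; case: c => //= _; lia.
Qed.

Lemma cycle_differ_count s : path.cycle differ s -> count id s = count negb s.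
Proof.
rewrite (cycle_path false) => /path_differ_count.
by case: s => [|b s] //= /addIn.
Qed.

Lemma cycle_eq_label (T : eqType) (f : T -> bool) (s : seq T) :
  path.cycle (fun x y => f x == f y) s -> {in s &, forall x y, f x = f y}.
Proof.
case: s => [|z s] //= cyc.
have first_label p w : path (fun x y => f x == f y) w p -> {in p, forall x, f w = f x}.
  elim: p w => [|y p IH] w //= /andP[/eqP-> /IH H] x.
  by rewrite inE => /predU1P[->|/H].
move=> x y; rewrite -!(mem_rcons s).
by move=> /(first_label _ _ cyc) <- /(first_label _ _ cyc).
Qed.

Section AroundAVertex.
Variables (G : plane_graph) (N : directed_modification G).
Implicit Types (A B : {set vertex G}) (F : {set directed_edge G}).
Implicit Types (om : {set edge G} * {set edge G}) (S : {set edge G}).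

Definition darts_at (v : vertex G) : seq (dart G) :=
  if corner N v is Some d then fingraph.orbit (Defs.rot G) (Defs.rot G d) else [::].

Lemma mem_darts_at v d : (d \in darts_at v) = (org d == v).
Proof.
rewrite /darts_at; case E: (corner N v) => [c|]; last first.
  by rewrite (negbTE (corner_NoneP E d)).
have [<- _] := cornerP E.
rewrite -fconnect_orbit -rotP eq_sym.
have /eqP-> // : org (Defs.rot G c) == org c.
by rewrite eq_sym rotP fconnect1.
Qed.

Lemma darts_at_uniq v : uniq (darts_at v).
Proof. by rewrite /darts_at; case: corner => // d; apply: orbit_uniq. Qed.

Definition outer_dirs A B (v : vertex G) : seq bool :=
  if insub v is Some w then
    if w \in W_circ N then nseq (v \in B) true ++ nseq (v \in A) false
    else nseq (v \in A) false ++ nseq (v \in B) true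
  else [::].

(** A slot is a dart, which stands for all the arcs replacing its edge, or a
source or sink arc, which is recorded by its direction. *)
Definition slot := (dart G + bool)%type.

Definition slots A B om (v : vertex G) : seq slot :=
  [seq inl d | d <- darts_at v & d.1 \in edges_of om]
  ++ [seq inr b | b <- outer_dirs A B v].

(** The direction, [true] meaning away from the vertex, of the last arc met when
sweeping counterclockwise over the slot.  [S] records this direction at the dart
[(e, true)] of each edge.  At the other end of the edge it is opposite when the
net flow along the edge is nonzero, i.e. on [om.1], and it is the same on [om.2],
where the middle and the side arc are met in the opposite order and have the
opposite directions. *)
Definition dir om S (s : slot) : bool :=
  match s with
  | inl d => (d.1 \in S) (+) (~~ d.2 && (d.1 \in om.1))
  | inr b => b
  end.

(** Whether the number of arcs in the slot is odd. *)
Definition crosses om (s : slot) : bool :=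
  if s is inl d then d.1 \in om.1 else true.

(** The arcs keep alternating when the sweep passes from [s] to [t]: the first arc
of [t] has direction [dir t] if [t] has an odd number of arcs and the opposite
direction otherwise. *)
Definition follows om S : rel slot :=
  fun s t => dir om S s == dir om S t (+) crosses om t.

Definition orientations A B om : {set {set edge G}} :=
  [set S : {set edge G} | (S \subset edges_of om) &&
    [forall v, path.cycle (follows om S) (slots A B om v)]].

Definition dart_dirs F (d : dart G) : seq bool :=
  [seq h.2 | h <- dart_half_arcs N d & h.1 \in F].

(** Two side arcs without the middle arc would be consecutive around the vertex and
have the same direction; every other set of arcs alternates within its slot. *)
Definition no_side_pair F (e : edge G) : bool :=
  (side (e, true) \in F) && (side (e, false) \in F) ==> (mid e \in F).

Definition sense F : {set edge G} :=
  [set e | last false (dart_dirs F (e, true))].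

Lemma edges_of_omega F e : (e \in edges_of (omega F)) = (0 < arc_count F e)%N.
Proof.
rewrite !inE /arc_count.
by case: (mid e \in F); case: (side _ \in F); case: (side _ \in F).
Qed.

Lemma dart_dirsE F d : dart_dirs F d =
  let out := d.2 == mid_dir N d.1 in
  nseq (side (opp_dart d) \in F) (~~ out) ++ nseq (mid d.1 \in F) out
  ++ nseq (side d \in F) (~~ out).
Proof.
rewrite /dart_dirs /=.
by case: (side _ \in F); case: (mid _ \in F); case: (side _ \in F).
Qed.

Lemma path_dart_dirs F d c : path differ c (dart_dirs F d) =
  no_side_pair F d.1 && ((d.1 \in edges_of (omega F)) ==>
     (c == last false (dart_dirs F d) (+) (d.1 \in (omega F).1))).
Proof.
rewrite dart_dirsE edges_of_omega inE /no_side_pair /arc_count /opp_dart.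
case: d => e b /=; case: (b == _); case: c; case: b => /=;
by case: (mid e \in F); case: (side (e, true) \in F); case: (side (e, false) \in F).
Qed.

Lemma last_dart_dirs F d c : last c (dart_dirs F d) =
  if d.1 \in edges_of (omega F) then last false (dart_dirs F d) else c.
Proof.
rewrite dart_dirsE edges_of_omega /arc_count /opp_dart.
case: d => e b /=; case: (b == _); case: c; case: b => /=;
by case: (mid e \in F); case: (side (e, true) \in F); case: (side (e, false) \in F).
Qed.

Lemma dir_sense F d : no_side_pair F d.1 ->
  dir (omega F) (sense F) (inl d) = last false (dart_dirs F d).
Proof.
rewrite /no_side_pair /= !inE !dart_dirsE /arc_count /opp_dart.
case: d => e b /=; case: (mid_dir N e); case: b => /=;
by case: (mid e \in F); case: (side (e, true) \in F); case: (side (e, false) \in F).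
Qed.

Lemma sense_sub F : sense F \subset edges_of (omega F).
Proof.
apply/subsetP=> e; rewrite edges_of_omega inE dart_dirsE /arc_count /opp_dart /=.
by case: (mid e \in F); case: (side (e, true) \in F); case: (side (e, false) \in F).
Qed.

Lemma path_darts F ds x :
  path differ (dir (omega F) (sense F) x) (flatten [seq dart_dirs F d | d <- ds]) =
  all (fun d => no_side_pair F d.1) ds &&
  path (follows (omega F) (sense F)) x
       [seq inl d | d <- ds & d.1 \in edges_of (omega F)].
Proof.
elim: ds x => [|d ds IH] x //=.
rewrite cat_path path_dart_dirs (last_dart_dirs _ _ (dir _ _ x)).
case ok: (no_side_pair F d.1) => //=.
rewrite -(dir_sense ok); case: ifP => _ /=; last exact: IH.
by have /= -> := IH (inl d); rewrite [RHS]andbCA.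
Qed.

Lemma last_darts F ds x : all (fun d => no_side_pair F d.1) ds ->
  last (dir (omega F) (sense F) x) (flatten [seq dart_dirs F d | d <- ds]) =
  dir (omega F) (sense F)
    (last x [seq inl d | d <- ds & d.1 \in edges_of (omega F)]).
Proof.
elim: ds x => [|d ds IH] x //= /andP[ok oks].
rewrite last_cat (last_dart_dirs _ _ (dir _ _ x)) -dir_sense //.
by case: ifP => _ /=; [apply: (IH (inl d)) | apply: IH].
Qed.

Lemma path_outer om S bs x :
  path differ (dir om S x) bs = path (follows om S) x [seq inr b | b <- bs].
Proof.
elim: bs x => [|b bs IH] x //=; rewrite -IH; congr (_ && _).
by rewrite /differ /follows /=; case: (dir om S x); case: b.
Qed.

Lemma last_outer om S bs x :
  last (dir om S x) bs = dir om S (last x [seq inr b | b <- bs]).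
Proof. by elim: bs x => [|b bs IH] x //=; rewrite -IH. Qed.

Definition has_ends A B F : bool :=
  [forall w : outer_vertex G, ((source_arc w \in F) == (val w \in A)) &&
     ((sink_arc w \in F) == (val w \in B))].

Lemma outer_dirsE A B F v : has_ends A B F ->
  [seq h.2 | h <- outer_half_arcs N v & h.1 \in F] = outer_dirs A B v.
Proof.
move=> /forallP H; rewrite /outer_half_arcs /outer_dirs.
case: insubP => // w _ vw; rewrite -vw.
have /andP[/eqP <- /eqP <-] := H w.
by case: ifP => _ /=; case: (source_arc w \in F); case: (sink_arc w \in F).
Qed.

Lemma half_arcs_dirs A B F v : has_ends A B F ->
  [seq h.2 | h <- half_arcs N v & h.1 \in F] =
  flatten [seq dart_dirs F d | d <- darts_at v] ++ outer_dirs A B v.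
Proof.
move=> H; rewrite /half_arcs filter_cat map_cat (outer_dirsE _ H); congr (_ ++ _).
rewrite /darts_at; case: (corner N v) => [d|] //.
by rewrite filter_flatten map_flatten -!map_comp.
Qed.

(** The word of directions around a vertex is read slot by slot.  A cyclic word is
read as a linear one starting from its own last letter; when there is no arc at
the vertex, the dummy letter [false], or the slot [inr false], plays this role
on both sides. *)
Lemma alternating_orientation A B F : has_ends A B F ->
  alternating N F =
  [forall e, no_side_pair F e] && (sense F \in orientations A B (omega F)).
Proof.
move=> H; rewrite inE sense_sub /=.
have vertex_eq v : path.cycle (fun b b' : bool => b != b')
      [seq h.2 | h <- half_arcs N v & h.1 \in F] =
    all (fun d => no_side_pair F d.1) (darts_at v) &&
    path.cycle (follows (omega F) (sense F)) (slots A B (omega F) v).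
  rewrite (half_arcs_dirs _ H) -/differ (cycle_path false) (cycle_path (inr false)).
  set om := omega F; set S := sense F; set D := flatten _; set O := outer_dirs A B v.
  have [oks|] := boolP (all _ (darts_at v)); last first.
    move=> noks; set c := last _ _; rewrite cat_path.
    by rewrite -[c]/(dir om S (inr c)) path_darts (negbTE noks).
  (* The last letter of the word is the direction of the last slot. *)
  have seam: last false (D ++ O) = dir om S (last (inr false) (slots A B om v)).
    by rewrite -[false]/(dir om S (inr false)) last_cat last_darts // last_outer
       /slots last_cat.
  by rewrite seam cat_path path_darts oks /= last_darts // path_outer /slots cat_path.
rewrite /alternating; under eq_forallb => v do rewrite vertex_eq.
apply/forallP/andP => [all_ok|[/forallP ok /forallP cyc] v]; last first.
  by rewrite cyc andbT; apply/allP.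
split; apply/forallP; last by move=> v; case/andP: (all_ok v).
move=> e; have /andP[/allP/(_ (e, true)) + _] := all_ok (org (e, true)).
by apply; rewrite mem_darts_at.
Qed.

End AroundAVertex.

(** * Flows with given induced configuration *)

Section Flows.
Variables (G : plane_graph) (N : directed_modification G).
Implicit Types (A B : {set vertex G}) (F : {set directed_edge G}).
Implicit Types (om : {set edge G} * {set edge G}) (S : {set edge G}).

(** The vertices of G visited by the flows inducing [om]. *)
Definition touched A B om : {set vertex G} :=
  [set v | [exists d, (org d == v) && (d.1 \in edges_of om)]] :|: (A :|: B).

Definition endpoint (b : bool) (a : directed_edge G) : dvertex G :=
  if b then arc_tail N a else arc_head N a.

(** Both sides count the tails, or the heads, at [v] of the arcs of F inside edges of
G, once by arcs and once by darts.  They already agree edge by edge, so loops need no special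
treatment. *)
Lemma endpoint_edge_half_arcs F (b : bool) v :
  (\sum_e (mid e \in F) * (endpoint b (mid e) == inner v)
   + \sum_d (side d \in F) * (endpoint b (side d) == inner v) =
   \sum_(d <- darts_at N v) count (fun c => c == b) (dart_dirs N F d))%N.
Proof.
rewrite (big_uniq _ (darts_at_uniq N v)) /=.
rewrite [RHS](eq_bigl (fun d => org d == v)); last by move=> d; rewrite mem_darts_at.
rewrite [RHS]big_mkcond /=.
have dart_sum (f : dart G -> nat) : (\sum_d f d = \sum_e \sum_t f (e, t))%N.
  by rewrite pair_big; apply: eq_bigr => -[].
rewrite !dart_sum -big_split /=.
apply: eq_bigr => e _; rewrite !big_bool /= !dart_dirsE /opp_dart /=.
rewrite !count_cat !count_nseq /endpoint /=.
have innerE u : (inner u == inner v) = (u == v) by apply/eqP/eqP => [[]|->].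
by case: b; case: (mid_dir N e); rewrite !innerE;
   case: (mid e \in F); case: (side _ \in F); case: (side _ \in F);
   case: (org _ == v); case: (org _ == v).
Qed.

Lemma endpoint_outer_half_arcs A B F (b : bool) v : has_ends A B F ->
  (\sum_w (source_arc w \in F) * (endpoint b (source_arc w) == inner v)
   + \sum_w (sink_arc w \in F) * (endpoint b (sink_arc w) == inner v) =
   count (fun c => c == b) (outer_dirs N A B v))%N.
Proof.
move=> H; rewrite -(outer_dirsE N v H) /outer_half_arcs -big_split /=.
have innerE u : (inner u == inner v) = (u == v) by apply/eqP/eqP => [[]|->].
case: insubP => [w0 _ vw|vout] /=.
  rewrite (bigD1 w0) //= big1 ?addn0 => [|w ww0].
    rewrite /endpoint /=; case: b; rewrite ?innerE vw eqxx;
    by case: ifP => _ /=; case: (source_arc w0 \in F); case: (sink_arc w0 \in F).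
  have vw': (val w == v) = false by rewrite -vw (inj_eq val_inj) (negbTE ww0).
  by rewrite /endpoint; case: b; rewrite /= ?innerE ?vw' ?muln0.
rewrite big1 // => w _.
have vw': (val w == v) = false.
  by apply: contraNF vout => /eqP <-; exact: valP.
by rewrite /endpoint; case: b; rewrite /= ?innerE ?vw' ?muln0.
Qed.

Lemma card_endpoint A B F (b : bool) v : has_ends A B F ->
  #|[set a in F | endpoint b a == inner v]| =
  count (fun c => c == b) [seq h.2 | h <- half_arcs N v & h.1 \in F].
Proof.
move=> H; rewrite (half_arcs_dirs N v H) count_cat count_flatten -map_comp.
rewrite sumnE big_map -endpoint_edge_half_arcs -(endpoint_outer_half_arcs b v H).
rewrite -sum1dep_card big_mkcond /= !big_sumType /= addnA.
by do !congr addn; apply: eq_bigr => i _; rewrite mulnb.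
Qed.

(** In an alternating cyclic word the two letters occur equally often, so
alternation implies conservation. *)
Lemma alternating_flow A B F : has_ends A B F -> alternating N F -> is_flow N F.
Proof.
move=> H /forallP alt; apply/forallP => v.
have := cycle_differ_count (alt v).
rewrite -[arc_head N]/(endpoint false) -[arc_tail N]/(endpoint true).
rewrite !(card_endpoint _ _ H) => E; apply/eqP.
rewrite (eq_count (a2 := negb)) ?(eq_count (a1 := eq_op^~ true) (a2 := id)) //;
by case.
Qed.

Lemma source_flow_vertices F w :
  (source w \in flow_vertices N F) = (source_arc w \in F).
Proof.
rewrite inE; apply/existsP/idP => [[a]|wF]; last first.
  by exists (source_arc w); rewrite wF /= eqxx.
case/andP=> aF /orP[] /eqP; case: a aF => [[[e|[e t]]|w']|w'] //= aF.
by case=> <-.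
Qed.

Lemma sink_flow_vertices F w :
  (sink w \in flow_vertices N F) = (sink_arc w \in F).
Proof.
rewrite inE; apply/existsP/idP => [[a]|wF]; last first.
  by exists (sink_arc w); rewrite wF /= eqxx ?orbT.
case/andP=> aF /orP[] /eqP; case: a aF => [[[e|[e t]]|w']|w'] //= aF.
by case=> <-.
Qed.

Lemma inner_flow_vertices A B F v :
  A \subset outer_vertices G -> B \subset outer_vertices G -> has_ends A B F ->
  (inner v \in flow_vertices N F) = (v \in touched A B (omega F)).
Proof.
move=> /subsetP hA /subsetP hB /forallP H.
rewrite !inE.
apply/existsP/idP.
  case=> a /andP[aF] inc.
  have on_edge e b : (0 < arc_count F e)%N -> org (e, b) = v ->
      [exists d, (org d == v) && (d.1 \in edges_of (omega F))].
    move=> eF ev; apply/existsP; exists (e, b).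
    by rewrite ev eqxx edges_of_omega.
  have mid_count e : mid e \in F -> (0 < arc_count F e)%N.
    by rewrite /arc_count => ->.
  have side_count e t : side (e, t) \in F -> (0 < arc_count F e)%N.
    by rewrite /arc_count; case: t => -> /=; rewrite addn1.
  case: a aF inc => [[[e|[e t]]|w]|w] aF /orP[] /eqP //= [] Ev.
  - by rewrite (on_edge _ _ (mid_count _ aF) Ev).
  - by rewrite (on_edge _ _ (mid_count _ aF) Ev).
  - by rewrite (on_edge _ _ (side_count _ _ aF) Ev).
  - by rewrite (on_edge _ _ (side_count _ _ aF) Ev).
  - have /andP[/eqP + _] := H w.
    by rewrite -Ev => <-; rewrite (_ : source_arc w \in F) ?orbT.
  - have /andP[_ /eqP] := H w.
    by rewrite -Ev => <-; rewrite (_ : sink_arc w \in F) ?orbT.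
case/orP => [/existsP[[e b] /andP[/eqP ev]]|].
  rewrite edges_of_omega /arc_count /=.
  have [mF _|mF] := boolP (mid e \in F).
    exists (mid e); rewrite mF /= -ev;
    by case: (mid_dir N e); case: b {ev}; rewrite eqxx ?orbT.
  have [sF _|sF] := boolP (side (e, true) \in F).
    exists (side (e, true)); rewrite sF /= -ev;
    by case: (mid_dir N e); case: b {ev}; rewrite eqxx ?orbT.
  have [sF' _|//] := boolP (side (e, false) \in F).
  exists (side (e, false)); rewrite sF' /= -ev;
  by case: (mid_dir N e); case: b {ev}; rewrite eqxx ?orbT.
case/orP => vAB.
  have := H (Sub v (hA _ vAB)); rewrite SubK vAB => /andP[/eqP wF _].
  by exists (source_arc (Sub v (hA _ vAB))); rewrite wF /= eqxx ?orbT.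
have := H (Sub v (hB _ vAB)); rewrite SubK vAB => /andP[_ /eqP wF].
by exists (sink_arc (Sub v (hB _ vAB))); rewrite wF /= eqxx.
Qed.

(** Conservation is implied by alternation, and alternation depends only on the
sense and on the induced configuration. *)
Lemma mem_alt_flows A B F : (F \in alt_flows N A B) =
  [&& has_ends A B F, [forall e, no_side_pair F e]
    & sense N F \in orientations N A B (omega F)].
Proof.
have endsE : ([forall w, (source w \in flow_vertices N F) == (val w \in A)] &&
    [forall w, (sink w \in flow_vertices N F) == (val w \in B)]) = has_ends A B F.
  apply/andP/forallP => [[/forallP a /forallP b] w|H].
    by rewrite -source_flow_vertices -sink_flow_vertices a b.
  by split; apply/forallP => w; have /andP[] := H w;
    rewrite -source_flow_vertices -sink_flow_vertices.
rewrite inE endsE; case ends: (has_ends A B F); last by rewrite !andbF.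
rewrite !andbT /= -(alternating_orientation N ends).
case alt: (alternating N F); rewrite ?andbF //.
by rewrite (alternating_flow ends).
Qed.

Lemma card_outer_vertex (U : {set vertex G}) : U \subset outer_vertices G ->
  #|[pred w : outer_vertex G | val w \in U]| = #|U|.
Proof.
move=> /subsetP hU; rewrite -(card_imset _ val_inj).
apply: eq_card => v; apply/imsetP/idP => [[w wU ->] //|vU].
by exists (Sub v (hU _ vU)); rewrite ?unfold_in /= ?SubK.
Qed.

Lemma card_flow_vertices A B F :
  A \subset outer_vertices G -> B \subset outer_vertices G -> has_ends A B F ->
  #|flow_vertices N F| = (#|touched A B (omega F)| + #|A| + #|B|)%N.
Proof.
move=> hA hB H.
rewrite -sum1_card !big_sumType /=; congr (_ + _ + _)%N.
- rewrite -sum1_card; apply: eq_bigl => v.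
  by rewrite -(inner_flow_vertices v hA hB H).
- rewrite -(card_outer_vertex hA) -sum1_card; apply: eq_bigl => w.
  rewrite -[inl (inr w)]/(source w) source_flow_vertices.
  by have /forallP/(_ w)/andP[/eqP-> _] := H.
- rewrite -(card_outer_vertex hB) -sum1_card; apply: eq_bigl => w.
  rewrite -[inr w]/(sink w) sink_flow_vertices.
  by have /forallP/(_ w)/andP[_ /eqP->] := H.
Qed.

End Flows.

(** * Components and even subgraphs *)

Section Components.
Variable G : plane_graph.
Implicit Types (om : {set edge G} * {set edge G}) (S E : {set edge G}).
Implicit Types (U D : {set vertex G}).

(** [U] is a union of components of the graph (V, E). *)
Definition saturated E U : bool :=
  [forall d : dart G, (d.1 \in E) ==> ((org d \in U) == (org (opp_dart d) \in U))].

Lemma saturated_step E U d : saturated E U -> d.1 \in E ->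
  (org d \in U) = (org (opp_dart d) \in U).
Proof. by move=> /forallP/(_ d)/implyP satU /satU/eqP. Qed.

Lemma component_eq om u v : (component om u == component om v) = (u \in component om v).
Proof.
set r := [rel a b | [exists d : dart G,
      [&& d.1 \in edges_of om, org d == a & org (opp_dart d) == b]]].
have r_sym : connect_sym r.
  have flip a b : r a b -> r b a.
    case/existsP=> -[e t] /and3P[/= dE da db]; apply/existsP; exists (e, ~~ t).
    by rewrite /opp_dart /= negbK dE da db.
  by apply: sym_connect_sym => a b; apply/idP/idP; apply: flip.
apply/eqP/idP => [<-|]; first by rewrite inE connect0.
rewrite inE => vu; apply/setP=> w; rewrite !inE.
by rewrite -(same_connect r_sym vu).
Qed.

Lemma saturated_component om U u v : saturated (edges_of om) U ->
  u \in component om v -> (u \in U) = (v \in U).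
Proof.
move=> satU; rewrite inE => vu; symmetry; move: vu; apply: closed_connect.
move=> a b /existsP[d /and3P[dE /eqP<- /eqP<-]].
exact: saturated_step satU dE.
Qed.

(** A union of components is the same as a set of components. *)
Lemma card_saturated om D : saturated (edges_of om) D ->
  #|[set U | saturated (edges_of om) U & U \subset D]| =
  (2 ^ #|[set component om v | v in D]|)%N.
Proof.
move=> satD; rewrite -card_powerset.
pose blocks U := [set component om v | v in U].
have blocksE U v : saturated (edges_of om) U ->
    (component om v \in blocks U) = (v \in U).
  move=> satU; apply/imsetP/idP => [[u uU /eqP]|vU]; last by exists v.
  by rewrite component_eq => /(saturated_component satU) ->.
rewrite -(card_in_imset (f := blocks)) => [|U U' /[!inE] /andP[sU _] /andP[sU' _] E].
  apply: eq_card => X; rewrite inE.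
  apply/imsetP/idP => [[U /[!inE] /andP[_ UD] ->]|/subsetP XD]; first exact: imsetS.
  exists [set v | component om v \in X].
    rewrite inE; apply/andP; split.
      apply/forallP => d; apply/implyP => dE; rewrite !inE.
      have /eqP-> // : component om (org d) == component om (org (opp_dart d)).
      rewrite eq_sym component_eq inE; apply: connect1; apply/existsP; exists d.
      by rewrite dE !eqxx.
    by apply/subsetP => v; rewrite inE => /XD; rewrite blocksE.
  apply/setP => x; apply/idP/imsetP => [xX|[v]]; last by rewrite inE => ? ->.
  by have /imsetP[v _ xv] := XD x xX; exists v; rewrite // inE -xv.
by apply/setP => v; rewrite -!blocksE // E.
Qed.

End Components.

Section CycleSpace.
Variables (G : plane_graph) (E : {set edge G}).
Implicit Types (S : {set edge G}) (U : {set vertex G}).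

Definition cut_sign U (e : edge G) : int :=
  (-1) ^+ ((org (e, true) \in U) + (org (e, false) \in U)).

(** The pairing of the boundary of [S] with [U] equals the pairing of [S] with the
coboundary of [U]. *)
Lemma prod_degree_sign S U :
  \prod_(v in U) (-1) ^+ degree S v = \prod_(e in S) cut_sign U e :> int.
Proof.
have deg_sum v : degree S v =
    (\sum_(e in S) ((org (e, true) == v) + (org (e, false) == v)))%N.
  rewrite /degree -sum1dep_card big_mkcond /= [RHS]big_mkcond /=.
  have dart_sum (f : dart G -> nat) : (\sum_d f d = \sum_e \sum_t f (e, t))%N.
    by rewrite pair_big; apply: eq_bigr => -[].
  rewrite dart_sum; apply: eq_bigr => e _; rewrite big_bool /=.
  by case: (e \in S); case: (org _ == v); case: (org _ == v).
rewrite -(big_morph _ (exprD (-1)) (expr0 (-1))) -(big_morph _ (exprD (-1)) (expr0 (-1))).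
congr (_ ^+ _); under eq_bigr => v _ do rewrite deg_sum.
rewrite exchange_big /=; apply: eq_bigr => e _; rewrite big_split /=.
have one u : (\sum_(v in U) (u == v) = (u \in U))%N.
  have [uU|uU] := boolP (u \in U).
    by rewrite (bigD1 u) //= eqxx big1 // => v /andP[_]; rewrite eq_sym => /negbTE->.
  by rewrite big1 // => v vU; case: eqP => // uv; rewrite uv vU in uU.
by rewrite !one.
Qed.

(** Euler's formula for the cycle space, obtained by summing the sign of
[prod_degree_sign] over all [S] inside [E] and all [U].  The sum over [U] first
vanishes unless all degrees of [S] are even; the sum over [S] first vanishes
unless no edge of [E] leaves [U]. *)
Lemma card_cycles : (#|[set S in E_ set0 | S \subset E]| * 2 ^ #|vertex G| =
  2 ^ #|E| * #|[set U | saturated E U]|)%N.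
Proof.
apply/eqP; rewrite -eqz_nat !PoszM; apply/eqP.
transitivity (\sum_(S : {set edge G} | S \subset E) \sum_(U : {set vertex G})
    \prod_(v in U) (-1) ^+ degree S v : int).
  have vertex_sum S : \sum_(U : {set vertex G}) \prod_(v in U) (-1) ^+ degree S v =
      (if odd_vertices S == set0 then (2 ^ #|vertex G|)%N%:Z else 0).
    transitivity (\prod_(v : vertex G) ((-1) ^+ degree S v + 1) : int).
      by rewrite bigA_distr; apply: eq_bigr => U _; rewrite big_mkcond.
    case: eqP => [odd0|/eqP/set0Pn[v]].
      rewrite -natz natrX -prodr_const; apply: eq_bigr => v _.
      move/setP/(_ v): odd0; rewrite !inE -signr_odd => ->.
      by rewrite expr0.
    by rewrite inE => oddv; rewrite (bigD1 v) //= -signr_odd oddv addNr mul0r.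
  under eq_bigr => S _ do rewrite vertex_sum.
  rewrite -big_mkcondr sumr_const -mulr_natl natz; congr (_%:Z * _).
  by apply: eq_card => S; rewrite !inE andbC.
rewrite exchange_big /=.
have edge_sum U : \sum_(S : {set edge G} | S \subset E)
      \prod_(v in U) (-1) ^+ degree S v =
    (if saturated E U then (2 ^ #|E|)%N%:Z else 0).
  transitivity (\prod_(e : edge G) ((e \in E)%:R * cut_sign U e + 1) : int).
    rewrite bigA_distr big_mkcond; apply: eq_bigr => S _.
    rewrite prod_degree_sign; case: ifP => [/subsetP SE|/negbT/subsetPn[e eS eE]].
      by rewrite big_mkcond; apply: eq_bigr => e _; case: ifP => // /SE->; rewrite mul1r.
    by rewrite (bigD1 e) //= eS (negbTE eE) mul0r mul0r.
  have cut1 e b : cut_sign U e = (-1) ^+ ((org (e, b) \in U) != (org (e, ~~ b) \in U)).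
    by rewrite /cut_sign -signr_odd oddD; case: b; case: (_ \in U); case: (_ \in U).
  case: ifP => [sat|/negbT]; last first.
    rewrite negb_forall => /existsP[[e b]]; rewrite negb_imply /= => /andP[eE cut].
    by rewrite (bigD1 e) //= eE mul1r (cut1 e b) cut addNr mul0r.
  rewrite -natz natrX -prodr_const [RHS]big_mkcond; apply: eq_bigr => e _.
  case: ifP => eE; last by rewrite mul0r add0r.
  by rewrite mul1r (cut1 e true) (saturated_step (d := (e, true)) sat eE) eqxx.
under eq_bigr => U _ do rewrite edge_sum.
rewrite -big_mkcond sumr_const -mulr_natr natz; congr (_ * _%:Z).
by apply: eq_card => U; rewrite !inE.
Qed.

End CycleSpace.

(** * Counting the senses of a configuration *)

Section Orientations.
Variables (G : plane_graph) (N : directed_modification G).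
Variables (A B : {set vertex G}) (om : {set edge G} * {set edge G}).
Hypotheses (hA : A \subset outer_vertices G) (hB : B \subset outer_vertices G).
Implicit Types (S : {set edge G}) (U : {set vertex G}).

(** The vertices around which the sense can be flipped.  Isolated vertices are left
out since flipping there changes nothing. *)
Definition free_vertices : {set vertex G} :=
  [set v in touched A B om |
    [forall u in component om v, u \notin A :|: B]].

Lemma mem_free v : (v \in free_vertices) =
  (v \in touched A B om) && [forall u in component om v, u \notin A :|: B].
Proof. by rewrite in_set. Qed.

Lemma dart_slot d : d.1 \in edges_of om -> inl d \in slots N A B om (org d).
Proof.
move=> dE; rewrite mem_cat map_f //.
by rewrite mem_filter dE mem_darts_at eqxx.
Qed.

Lemma slotsP v s : s \in slots N A B om v ->
  match s with
  | inl d => org d = v /\ d.1 \in edges_of om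
  | inr b => v \in A :|: B
  end.
Proof.
rewrite mem_cat => /orP[] /mapP[x + ->].
  by rewrite mem_filter mem_darts_at => /andP[? /eqP].
rewrite /outer_dirs inE; case: insubP => // w _ _; case: ifP => _;
rewrite mem_cat !mem_nseq; by case: (v \in A); case: (v \in B).
Qed.

Lemma outer_slot v : v \in A :|: B -> exists b, inr b \in slots N A B om v.
Proof.
move=> vAB; have vW : v \in outer_vertices G.
  by move: vAB; rewrite inE => /orP[/(subsetP hA)|/(subsetP hB)].
suff [b bv] : exists b, b \in outer_dirs N A B v.
  by exists b; rewrite mem_cat map_f // orbT.
move: vAB; rewrite /outer_dirs inE insubT => vAB.
exists (v \notin A); case: ifP => _; rewrite mem_cat !mem_nseq;
by move: vAB; case: (v \in A); case: (v \in B).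
Qed.

Lemma touched_dart d : d.1 \in edges_of om -> org d \in touched A B om.
Proof.
move=> dE; rewrite in_setU inE; apply/orP; left; apply/existsP; exists d.
by rewrite eqxx.
Qed.

Lemma component_refl v : v \in component om v.
Proof. by rewrite -component_eq. Qed.

Lemma component_dart d : d.1 \in edges_of om ->
  component om (org d) = component om (org (opp_dart d)).
Proof.
move=> dE; apply/eqP; rewrite eq_sym component_eq inE; apply: connect1.
by apply/existsP; exists d; rewrite dE !eqxx.
Qed.

Lemma saturated_free : saturated (edges_of om) free_vertices.
Proof.
apply/forallP => d; apply/implyP => dE.
by rewrite !mem_free !touched_dart // (component_dart dE).
Qed.

Definition flip_on S U : {set edge G} :=
  [set e | (e \in S) (+) ((e \in edges_of om) && (org (e, true) \in U))].

Lemma saturated_tail U d : saturated (edges_of om) U -> d.1 \in edges_of om ->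
  (org (d.1, true) \in U) = (org d \in U).
Proof.
case: d => e [] //= satU eE.
exact: (saturated_step (d := (e, true)) satU eE).
Qed.

Lemma free_disjoint v : v \in A :|: B -> v \notin free_vertices.
Proof.
move=> vAB; rewrite mem_free negb_and; apply/orP; right.
by apply/forall_inPn; exists v; rewrite ?component_refl ?negbK.
Qed.

(** Around each vertex, either all directions change or none, and none changes
where a source or sink imposes its own. *)
Lemma flip_on_orientation S U : saturated (edges_of om) U ->
  U \subset free_vertices -> S \in orientations N A B om ->
  flip_on S U \in orientations N A B om.
Proof.
move=> satU /subsetP Ufree; rewrite !inE => /andP[/subsetP SE /forallP cyc].
apply/andP; split.
  by apply/subsetP => e; rewrite inE; case: (e \in S) (SE e) => [-> //|_ /andP[]].
apply/forallP => v.
have slots_all : all (mem (slots N A B om v)) (slots N A B om v) by exact/allP.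
rewrite -(eq_in_cycle (e := follows om S) _ slots_all) ?cyc //.
have dir_flip s : s \in slots N A B om v ->
    dir om (flip_on S U) s = dir om S s (+) (v \in U).
  move/slotsP; case: s => [d [<- dE]|b vAB] /=.
    by rewrite inE dE saturated_tail //= addbAC.
  by rewrite (contraNF (Ufree v)) ?addbF // free_disjoint.
move=> s t sv tv; rewrite /follows !dir_flip //.
by case: (v \in U); case: (dir om S s); case: (dir om S t); case: (crosses om t).
Qed.

Lemma flip_on_inj S U U' :
  saturated (edges_of om) U -> U \subset free_vertices ->
  saturated (edges_of om) U' -> U' \subset free_vertices ->
  flip_on S U = flip_on S U' -> U = U'.
Proof.
move=> satU /subsetP UF satU' /subsetP UF' /setP eqU; apply/setP => v.
have [vF|vF] := boolP (v \in free_vertices); last first.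
  by rewrite (contraNF (UF v)) // (contraNF (UF' v)).
have := vF; rewrite mem_free in_setU => /andP[/orP[vE|vAB] _]; last first.
  by rewrite (negbTE (free_disjoint vAB)) in vF.
have := vE; rewrite inE => /existsP[d /andP[/eqP <- dE]].
have := eqU d.1; rewrite !inE -in_setU -/(edges_of om) dE !saturated_tail //=.
by move/addbI.
Qed.

(** Whether [S] and [S0] disagree at a slot does not depend on the slot around a
vertex, since both satisfy the same recursion there. *)
Lemma orientation_flip S0 S : S0 \in orientations N A B om ->
  S \in orientations N A B om ->
  exists U, [/\ saturated (edges_of om) U, U \subset free_vertices
            & S = flip_on S0 U].
Proof.
rewrite !inE => /andP[/subsetP S0E /forallP cyc0] /andP[/subsetP SE /forallP cyc].
pose delta s := dir om S s (+) dir om S0 s.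
have delta_const v : {in slots N A B om v &, forall s t, delta s = delta t}.
  apply: cycle_eq_label; have := conj (cyc v) (cyc0 v) => /andP.
  rewrite -cycle_relI; apply: sub_cycle => s t /andP[/eqP st /eqP st0].
  by rewrite /delta st st0 addbACA addbb addbF.
pose U := [set v | [exists d, [&& org d == v, d.1 \in edges_of om
                                & (d.1 \in S) (+) (d.1 \in S0)]]].
have delta_dart d : delta (inl d) = (d.1 \in S) (+) (d.1 \in S0).
  by rewrite /delta /= addbACA addbb addbF.
have UE d : d.1 \in edges_of om -> (org d \in U) = (d.1 \in S) (+) (d.1 \in S0).
  move=> dE; rewrite inE; apply/existsP/idP => [[d' /and3P[/eqP dd' dE' +]]|?].
    rewrite -!delta_dart (delta_const (org d) _ (inl d)) ?dart_slot //.
    by rewrite -dd' dart_slot.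
  by exists d; rewrite eqxx dE.
have satU : saturated (edges_of om) U.
  by apply/forallP => d; apply/implyP => dE; rewrite !UE.
have UAB v : v \in U -> v \notin A :|: B.
  rewrite inE => /existsP[d /and3P[/eqP <- dE dS]]; apply/negP => /outer_slot[b bv].
  move: dS; rewrite -delta_dart (delta_const _ _ _ (dart_slot dE) bv).
  by rewrite /delta addbb.
exists U; split=> //.
  apply/subsetP => v vU; rewrite mem_free; apply/andP; split.
    by move: vU; rewrite inE => /existsP[d /and3P[/eqP <- dE _]]; apply: touched_dart.
  by apply/forall_inP => u /(saturated_component satU); rewrite vU => /UAB.
apply/setP => e; rewrite inE; case eE: (e \in edges_of om) => /=.
  by rewrite (UE (e, true)) //= addbCA addbb addbF.
by rewrite addbF (contraFF (SE e) eE) (contraFF (S0E e) eE).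
Qed.

Lemma card_orientations S0 : S0 \in orientations N A B om ->
  #|orientations N A B om| = (2 ^ #|[set component om v | v in free_vertices]|)%N.
Proof.
move=> S0o; rewrite -card_saturated ?saturated_free //.
rewrite -(card_in_imset (f := flip_on S0)); last first.
  by move=> U U' /[!inE] /andP[? ?] /andP[? ?]; apply: flip_on_inj.
apply: eq_card => S; apply/idP/imsetP => [So|[U /[!inE] /andP[? ?] ->]].
  have [U [? ? ->]] := orientation_flip S0o So.
  by exists U; rewrite // inE; apply/andP.
by have := @flip_on_orientation S0 U; rewrite !inE => -> //; rewrite inE in S0o.
Qed.

Lemma component_untouched u v : v \notin touched A B om ->
  u \in component om v -> u = v.
Proof.
move=> vT uv; apply/set1P.
rewrite (saturated_component _ uv) ?set11 //.
apply/forallP => d; apply/implyP => dE; rewrite !inE.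
have not_v d' : d'.1 \in edges_of om -> (org d' == v) = false.
  by move=> dE'; apply: contraNF vT => /eqP <-; apply: touched_dart.
by rewrite !not_v.
Qed.

(** The components fall into three classes: those with an edge that avoid A and B,
those that meet A or B, and the remaining isolated vertices. *)
Lemma card_components :
  (#|[set component om v | v in free_vertices]| + kprime A B om
     + (#|vertex G| - #|touched A B om|) =
   #|[set component om v | v in setT]|)%N.
Proof.
have ABT v : v \in A :|: B -> v \in touched A B om.
  by move=> vAB; rewrite in_setU vAB orbT.
have -> : (#|vertex G| - #|touched A B om| =
    #|[set component om v | v in ~: touched A B om]|)%N.
  have inj : {in ~: touched A B om &, injective (component om)}.
    move=> u v _; rewrite in_setC => vT uv.
    by apply: (component_untouched vT); rewrite -component_eq uv.
  by rewrite (card_in_imset inj) -(cardsC (touched A B om)) addKn.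
have disjoint_card (P Q : {set {set vertex G}}) :
    (forall X, X \in P -> X \notin Q) -> (#|P| + #|Q| = #|P :|: Q|)%N.
  move=> PQ; rewrite cardsU (_ : P :&: Q = set0) ?cards0 ?subn0 //.
  by apply/setP => X; rewrite !inE; apply/negP => /andP[/PQ/negP].
rewrite /kprime !disjoint_card.
- apply: eq_card => X; apply/idP/imsetP => [|[v _ ->]].
    by case/finset.setUP => [/finset.setUP[]|] /imsetP[v _ ->]; exists v; rewrite ?inE.
  rewrite !in_setU; have [vT|vT] := boolP (v \in touched A B om); last first.
    by rewrite (imset_f _ (_ : v \in ~: touched A B om)) ?orbT // in_setC.
  have [vF|] := boolP (v \in free_vertices); first by rewrite imset_f.
  rewrite mem_free vT => /forall_inPn[u uv]; rewrite negbK => uAB.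
  have /eqP <- : component om u == component om v by rewrite component_eq.
  by rewrite (imset_f _ uAB) ?orbT.
- move=> X XFAB; apply/imsetP => -[v /[!in_setC] vT Xv].
  have untouched u : X = component om u -> u = v.
    by move=> Xu; apply: (component_untouched vT); rewrite -component_eq -Xu -Xv.
  case/finset.setUP: XFAB => /imsetP[u + /untouched uv]; rewrite uv.
    by rewrite mem_free => /andP[vT']; rewrite vT' in vT.
  by move/ABT; rewrite (negbTE vT).
- move=> _ /imsetP[u uF ->]; apply/imsetP => -[v vAB /eqP].
  rewrite eq_sym component_eq => vu; move: uF; rewrite mem_free => /andP[_].
  by move/forall_inP/(_ v vu); rewrite vAB.
Qed.

Lemma orientations_cycles S0 : S0 \in orientations N A B om ->
  (#|orientations N A B om| * 2 ^ (#|edges_of om| + kprime A B om) =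
   #|E_empty_in om| * 2 ^ #|touched A B om|)%N.
Proof.
move=> /card_orientations ->; set f := #|[set component om v | v in free_vertices]|.
set k := kprime A B om.
have cycles := card_cycles (edges_of om).
have satE : #|[set U | saturated (edges_of om) U]| =
    (2 ^ (f + k + (#|vertex G| - #|touched A B om|)))%N.
  rewrite card_components -card_saturated.
    by apply: eq_card => U; rewrite !inE subsetT andbT.
  by apply/forallP => d; rewrite !inE eqxx implybT.
apply/eqP; rewrite -(eqn_pmul2r (expn_gt0 2 (#|vertex G| - #|touched A B om|))).
rewrite -[X in _ == X]mulnA -[X in _ == (_ * X)%N]expnD subnKC ?max_card // cycles satE.
by rewrite -!expnD; apply/eqP; congr (2 ^ _)%N; lia.
Qed.

End Orientations.

(** * Exchanging sources and sinks *)

Section Reversal.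
Variable G : plane_graph.
Implicit Types (N : directed_modification G) (A B : {set vertex G}).
Implicit Types (om : {set edge G} * {set edge G}) (S : {set edge G}).

(** Reversing all arcs turns the data on the left into the data on the right: the
half-arcs in the outer face are used in the same places, with opposite
directions. *)
Definition reversed N A B N' A' B' : Prop :=
  corner N' = corner N /\
  forall v, outer_dirs N' A' B' v = [seq ~~ b | b <- outer_dirs N A B v].

Lemma reversed_sym N A B N' A' B' :
  reversed N A B N' A' B' -> reversed N' A' B' N A B.
Proof.
case=> eqc eqd; split=> // v; rewrite eqd -map_comp -[LHS]map_id.
by apply: eq_map => b /=; rewrite negbK.
Qed.

Lemma reversed_orientation N A B N' A' B' om S : reversed N A B N' A' B' ->
  S \in orientations N A B om ->
  edges_of om :\: S \in orientations N' A' B' om.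
Proof.
case=> eqc eqd; rewrite !inE subsetDl => /andP[SE /forallP cyc] /=.
apply/forallP => v.
pose flip (s : slot G) : slot G := if s is inr b then inr (~~ b) else s.
have -> : slots N' A' B' om v = [seq flip s | s <- slots N A B om v].
  rewrite /slots map_cat -!map_comp eqd -map_comp; congr (_ ++ _).
  by rewrite /darts_at eqc.
have slots_all : all (mem (slots N A B om v)) (slots N A B om v) by exact/allP.
rewrite cycle_map -(eq_in_cycle (e := follows om S) _ slots_all) ?cyc //.
have dir_flip s : s \in slots N A B om v ->
    dir om (edges_of om :\: S) (flip s) = ~~ dir om S s.
  move/slotsP; case: s => [d [_ dE]|//].
  by rewrite /dir /flip in_setD dE andbT addNb.
have crosses_flip s : crosses om (flip s) = crosses om s by case: s.
move=> s t sv tv; rewrite /follows /= !dir_flip // crosses_flip.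
by case: (dir om S s); case: (dir om S t); case: (crosses om t).
Qed.

Lemma leq_card_orientations N A B N' A' B' om : reversed N A B N' A' B' ->
  (#|orientations N A B om| <= #|orientations N' A' B' om|)%N.
Proof.
move=> rev; rewrite -(card_in_imset (f := fun S => edges_of om :\: S)).
  by apply/subset_leq_card/subsetP => _ /imsetP[S So ->]; apply: reversed_orientation So.
have twice S : S \in orientations N A B om -> edges_of om :\: (edges_of om :\: S) = S.
  by rewrite inE => /andP[/setIidPr SE _]; rewrite setDDr setDv set0U.
by move=> S S' /twice {2}<- /twice {2}<- ->.
Qed.

Lemma reversed_card_orientations N A B N' A' B' om : reversed N A B N' A' B' ->
  #|orientations N A B om| = #|orientations N' A' B' om|.
Proof.
move=> rev; apply/eqP; rewrite eqn_leq !leq_card_orientations //.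
exact: reversed_sym.
Qed.

Lemma reversed_swap N A B : reversed N A B (swap_circ_bullet N) B A.
Proof.
split=> // v; rewrite /outer_dirs; case: insub => // w.
by rewrite /= in_setC; case: (w \in W_circ N); rewrite /= map_cat !map_nseq.
Qed.

Lemma reversed_disjoint N A B : [disjoint A & B] -> reversed N A B N B A.
Proof.
move=> /pred0P AB; split=> // v; rewrite /outer_dirs; case: insub => // w.
have /= := AB v; case: ifP => _; case: (v \in A); case: (v \in B) => //.
Qed.

End Reversal.

(** * The mass of a configuration *)

Section Weights.
Variables (R : realType) (G : plane_graph) (J : edge G -> R).
Variable N : directed_modification G.
Variables (A B : {set vertex G}).
Hypotheses (hA : A \subset outer_vertices G) (hB : B \subset outer_vertices G).
Implicit Types (F : {set directed_edge G}) (S : {set edge G}).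
Implicit Types (om : {set edge G} * {set edge G}).
Local Notation x := (x_ J).

Lemma cosh_neq0 (t : R) : cosh t != 0.
Proof. by rewrite gt_eqF // divr_gt0 // addr_gt0 // expR_gt0. Qed.

Lemma cosh2_sinh2 (t : R) : cosh t ^+ 2 - sinh t ^+ 2 = 1.
Proof.
rewrite /cosh /sinh expRN; have := expR_gt0 t; move: (expR t) => a a0.
by field; rewrite gt_eqF.
Qed.

Lemma tanh_subr1 (t : R) : 1 - tanh t ^+ 2 = (cosh t ^+ 2)^-1.
Proof.
have c0 := cosh_neq0 t; apply: (mulIf (expf_neq0 2 c0)).
by rewrite mulVf ?expf_neq0 // -[RHS](cosh2_sinh2 t) /tanh; field.
Qed.

Lemma x_sqr_neq1 e : 1 - x e ^+ 2 != 0.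
Proof. by rewrite tanh_subr1 invr_neq0 ?expf_neq0 ?cosh_neq0. Qed.

Lemma sinh_double (t : R) : sinh (2 * t) = 2 * tanh t / (1 - tanh t ^+ 2).
Proof.
rewrite tanh_subr1 invrK /tanh.
rewrite -mulrA -mulrA [_^-1 * _](_ : _ = cosh t); last first.
  by rewrite expr2 mulKf ?cosh_neq0.
rewrite /sinh /cosh -mulrN !mulr2n !mulrDl !mul1r !expRD !expRN.
have := expR_gt0 t; move: (expR t) => a a0.
by field; rewrite gt_eqF.
Qed.

Definition pattern := (bool * bool * bool)%type.

Definition pattern_of F : {ffun edge G -> pattern} :=
  [ffun e => (mid e \in F, side (e, true) \in F, side (e, false) \in F)].

Definition flow_of (f : {ffun edge G -> pattern}) : {set directed_edge G} :=
  [set a | match a with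
           | inl (inl (inl e)) => (f e).1.1
           | inl (inl (inr (e, t))) => if t then (f e).1.2 else (f e).2
           | inl (inr w) => val w \in A
           | inr w => val w \in B
           end].

Lemma flow_ofK : cancel flow_of pattern_of.
Proof.
by move=> f; apply/ffunP => e; rewrite ffunE !inE /=; case: (f e) => [[? ?] ?].
Qed.

Lemma pattern_ofK F : has_ends A B F -> flow_of (pattern_of F) = F.
Proof.
move=> /forallP H; apply/setP => -[[[e|[e t]]|w]|w]; rewrite !inE ?ffunE //.
- by case: t.
- by have /andP[/eqP <- _] := H w.
- by have /andP[_ /eqP <-] := H w.
Qed.

Lemma flow_of_ends f : has_ends A B (flow_of f).
Proof. by apply/forallP => w; rewrite !inE !eqxx. Qed.

(** The product of the weights of the arcs in the edge, each of them doubled to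
account for the factor [2 ^ #|F|]. *)
Definition pattern_weight e (p : pattern) : R :=
  (if p.1.1 then 2 * x e / (1 - x e ^+ 2) else 1)
  * (if p.1.2 then x e else 1) * (if p.2 then x e else 1).

(** The |A| + |B| source and sink arcs double the weight as often as the sources and
sinks they are incident to halve it. *)
Lemma flow_weightE F : has_ends A B F ->
  flow_weight J N A F =
  2 ^ (#|A|%:Z - #|touched A B (omega F)|%:Z)
  * \prod_e pattern_weight e (pattern_of F e).
Proof.
move=> H; rewrite /flow_weight (card_flow_vertices N hA hB H).
have prod_outer (U : {set vertex G}) : U \subset outer_vertices G ->
    \prod_(w : outer_vertex G) (if val w \in U then 2 else 1) = 2 ^+ #|U| :> R.
  by move=> /card_outer_vertex <-; rewrite -big_mkcond prodr_const.
have weights : 2 ^+ #|F| * \prod_(a in F) arc_weight J a =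
    (\prod_e pattern_weight e (pattern_of F e)) * 2 ^+ #|A| * 2 ^+ #|B|.
  rewrite -prodr_const -big_split /= big_mkcond !big_sumType /=.
  rewrite -(prod_outer _ hA) -(prod_outer _ hB).
  congr (_ * _ * _).
  - have dart_prod (g : dart G -> R) : \prod_d g d = \prod_e \prod_t g (e, t).
      by rewrite pair_big; apply: eq_bigr => -[].
    rewrite dart_prod -big_split; apply: eq_bigr => e _.
    rewrite big_bool /pattern_weight ffunE /= mulrA.
    have half (z : R) : 2 * (z / 2) = z by field.
    by rewrite !half sinh_double.
  - apply: eq_bigr => w _; rewrite mulr1.
    by have /forallP/(_ w)/andP[/eqP <- _] := H.
  - apply: eq_bigr => w _; rewrite mulr1.
    by have /forallP/(_ w)/andP[_ /eqP <-] := H.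
have two0 : (2 : R) != 0 by rewrite pnatr_eq0.
rewrite (_ : #|A|%:Z + #|F|%:Z - _ =
  (#|A|%:Z - #|touched A B (omega F)|%:Z) + (#|F|%:Z - (#|A| + #|B|)%N%:Z)); last by lia.
rewrite expfzDr // -mulrA; congr (_ * _).
rewrite expfzDr // mulrAC weights -invr_expz -[_ ^ Posz _]/(2 ^+ _).
by rewrite -[X in X / _]mulrA -exprD mulfK ?expf_neq0.
Qed.

(** The sets of arcs in an edge that are compatible with [om] and with the bit of [S];
[out] is the direction of the middle arc at the dart [(e, true)]. *)
Definition admissible om S e : pred pattern := fun p =>
  let out := true == mid_dir N e in
  let n := (p.1.1 + p.1.2 + p.2)%N in
  [&& p.1.2 && p.2 ==> p.1.1, odd n == (e \in om.1), (n == 2) == (e \in om.2)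
    & last false (nseq p.2 (~~ out) ++ nseq p.1.1 out ++ nseq p.1.2 (~~ out))
      == (e \in S)].

Lemma admissible_family om S F : (pattern_of F \in family (admissible om S)) =
  [&& [forall e, no_side_pair F e], omega F == om & sense N F == S].
Proof.
apply/familyP/and3P => [adm|[/forallP ok /eqP <- /eqP <-] e]; last first.
  rewrite unfold_in ffunE /= !inE dart_dirsE /= !eqxx.
  by have := ok e; rewrite /no_side_pair => ->.
have {}adm e : admissible om S e (pattern_of F e) by exact: adm.
split.
- by apply/forallP => e; have /and4P[] := adm e; rewrite ffunE.
- rewrite [om]surjective_pairing; apply/eqP; congr (_, _); apply/setP => e;
  rewrite inE; have := adm e; rewrite /admissible ffunE /=;
  by case/and4P=> _ /eqP odd_om1 /eqP two_om2 _; rewrite -?odd_om1 -?two_om2.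
- apply/eqP/setP => e; rewrite inE dart_dirsE.
  by have /and4P[_ _ _ /eqP <-] := adm e; rewrite ffunE.
Qed.

Definition edge_mass om e : R :=
  if e \in om.1 then
    if e \in om.2 then 0 else 2 * x e / (1 - x e ^+ 2)
  else if e \in om.2 then 2 * x e ^+ 2 / (1 - x e ^+ 2) else 1.

(** On [om.1], one value of the bit is realized by the middle arc alone, of weight
[2 x / (1 - x^2)], and the other one by each side arc and by all three arcs, of
total weight [x + x + 2 x^3 / (1 - x^2)], which is the same number.  On [om.2] the
bit tells which side arc is used. *)
Lemma sum_admissible om S e : S \subset edges_of om ->
  \sum_(p | admissible om S e p) pattern_weight e p = edge_mass om e.
Proof.
move=> /subsetP/(_ e); rewrite inE => SE.
have pattern_sum (g : pattern -> R) : \sum_p g p = \sum_m \sum_l \sum_r g (m, l, r).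
  by rewrite !pair_big; apply: eq_bigr => -[[]].
rewrite big_mkcond pattern_sum !big_bool /admissible /pattern_weight /edge_mass /=.
have := x_sqr_neq1 e.
by move: SE; case: (e \in S); case: (e \in om.1); case: (e \in om.2) => //=;
  try (by move/(_ isT)); move=> _ x1; case: (mid_dir N e) => /=; field.
Qed.

Definition mass om : R :=
  \sum_(F in alt_flows N A B | omega F == om) flow_weight J N A F.

(** The sum over flows is organized by sense, and for each sense the arc sets in
different edges can be chosen independently. *)
Lemma massE om : mass om =
  2 ^ (#|A|%:Z - #|touched A B om|%:Z) * (\prod_e edge_mass om e)
  * #|orientations N A B om|%:R.
Proof.
rewrite /mass (partition_big (sense N) [in orientations N A B om]); last first.
  by move=> F; rewrite mem_alt_flows => /andP[/and3P[_ _ So] /eqP <-]; exact: So.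
rewrite mulr_natr -sumr_const; apply: eq_bigr => S So.
have SE : S \subset edges_of om by move: So; rewrite inE => /andP[].
rewrite (reindex_onto flow_of pattern_of) => [|F]; last first.
  by rewrite mem_alt_flows => /andP[/andP[/and3P[/pattern_ofK]]].
rewrite -(eq_bigr _ (fun e _ => sum_admissible e SE)) bigA_distr_big_dep mulr_sumr.
apply: eq_big => [f|f /andP[/andP[/andP[_ /eqP omf] _] _]]; last first.
  by rewrite flow_weightE ?flow_of_ends // omf flow_ofK.
rewrite flow_ofK eqxx andbT -[X in _ = (X \in _)]flow_ofK.
rewrite admissible_family mem_alt_flows flow_of_ends.
case: (boolP [forall e, _]) => //= _.
have [->|] := eqVneq; last by rewrite !andbF.
by rewrite andbT; have [->|_] := eqVneq; rewrite ?andbF // So.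
Qed.

Lemma Pbar_mass om : Pbar_aflow J N A B om = mass om / Z_aflow J N A B.
Proof.
rewrite /Pbar_aflow /P_aflow -big_mkcondr mulr_suml.
by apply: eq_bigl => F; rewrite andbC.
Qed.

Lemma Z_mass : Z_aflow J N A B = \sum_om mass om.
Proof. exact: partition_big. Qed.

Lemma prod_edge_mass om : [disjoint om.1 & om.2] ->
  (\prod_e edge_mass om e) * \prod_(e : edge G) (1 - x e ^+ 2) =
  2 ^+ #|edges_of om| * \prod_(e in om.1) x e * \prod_(e in om.2) x e ^+ 2
  * \prod_(e in ~: edges_of om) (1 - x e ^+ 2).
Proof.
move=> /pred0P dis; rewrite -prodr_const.
rewrite [X in X * _ * _ * _]big_mkcond [X in _ * X * _ * _]big_mkcond.
rewrite [X in _ * _ * X * _]big_mkcond [X in _ * _ * _ * X]big_mkcond.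
rewrite -!big_split; apply: eq_bigr => e _; rewrite !inE /edge_mass /=.
have := x_sqr_neq1 e; have /= := dis e.
by case: (e \in om.1); case: (e \in om.2) => //= _ x1; field.
Qed.

End Weights.

Lemma mass_reversed (R : realType) (G : plane_graph) (J : edge G -> R)
    (N N' : directed_modification G) (A B : {set vertex G}) om :
  A \subset outer_vertices G -> B \subset outer_vertices G -> #|A| = #|B| ->
  reversed N A B N' B A -> mass J N A B om = mass J N' B A om.
Proof.
move=> hA hB hAB rev; rewrite !massE // (reversed_card_orientations _ rev) hAB.
by rewrite /touched setUC [A :|: B]setUC setUC.
Qed.

Lemma Pbar_reversed (R : realType) (G : plane_graph) (J : edge G -> R)
    (N N' : directed_modification G) (A B : {set vertex G}) :
  A \subset outer_vertices G -> B \subset outer_vertices G -> #|A| = #|B| ->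
  reversed N A B N' B A -> Pbar_aflow J N A B =1 Pbar_aflow J N' B A.
Proof.
move=> hA hB hAB rev om; rewrite !Pbar_mass !Z_mass.
congr (_ / _); first exact: mass_reversed.
by apply: eq_bigr => om' _; apply: mass_reversed.
Qed.

Theorem theorem4p1 (R : realType) (G : plane_graph) (J : edge G -> R)
    (hJ : forall e, 0 < J e) (N : directed_modification G)
    (A B : {set vertex G})
    (hA : A \subset outer_vertices G) (hB : B \subset outer_vertices G)
    (hAB : #|A| = #|B|) :
  (forall om : {set edge G} * {set edge G}, om \in Gamma N A B ->
     Pbar_aflow J N A B om =
       (Zbar_aflow J N A B)^-1
       * (2 : R) ^ (#|A|%:Z - (kprime A B om)%:Z)
       * #|E_empty_in om|%:R
       * \prod_(e in om.1) x_ J e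
       * \prod_(e in om.2) x_ J e ^+ 2
       * \prod_(e in ~: edges_of om) (1 - x_ J e ^+ 2))
  /\ ([disjoint A & B] -> Pbar_aflow J N A B =1 Pbar_aflow J N B A)
  /\ Pbar_aflow J N A B =1 Pbar_aflow J (swap_circ_bullet N) B A.
Proof.
split; last first.
  split; first by move=> AB; apply: Pbar_reversed => //; apply: reversed_disjoint.
  by apply: Pbar_reversed => //; apply: reversed_swap.
move=> om /imsetP[F]; rewrite mem_alt_flows => /and3P[_ _ So] omF.
rewrite -omF in So; have dis : [disjoint om.1 & om.2].
  rewrite omF; apply/pred0P => e /=; rewrite !inE.
  by case: eqP => [->|]; rewrite ?andbF.
have P0 : \prod_(e : edge G) (1 - x_ J e ^+ 2) != 0.
  by apply/prodf_neq0 => e _; apply: x_sqr_neq1.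
rewrite Pbar_mass massE // /Zbar_aflow invfM.
rewrite -(mulfK P0 (\prod_e edge_mass J om e)) prod_edge_mass //.
have two0 : (2 : R) != 0 by rewrite pnatr_eq0.
have two_pow n : (2 : R) ^+ n != 0 by rewrite expf_neq0.
have : (#|orientations N A B om| * 2 ^ (#|edges_of om| + kprime A B om))%:R =
       (#|E_empty_in om| * 2 ^ #|touched A B om|)%:R :> R.
  by congr (_%:R); apply: orientations_cycles So.
rewrite !natrM !natrX exprD !expfzDr // -!invr_expz => cycles.
have -> : #|orientations N A B om|%:R = #|E_empty_in om|%:R * 2 ^+ #|touched A B om|
    / (2 ^+ #|edges_of om| * 2 ^+ kprime A B om) :> R.
  by rewrite -cycles mulfK ?mulf_neq0.
rewrite -![_ ^ Posz _]/(2 ^+ _).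
(* The normalization and the products over edges stay opaque here; only the powers
   of two cancel. *)
have regroup (a t w k n p q r z u : R) : t != 0 -> w != 0 -> k != 0 ->
    a / t * (w * p * q * r * u) * (n * t / (w * k)) * z =
    z * u * (a / k) * n * p * q * r.
  by move=> t0 w0 k0; field; rewrite t0 w0 k0.
exact: regroup.
Qed.
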